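(* Let $M_1$ be a Markov kernel from $\mathsf{X}$ to $(\mathsf{T}_1,\mathcal{T}_1)$ and $M_2$ a Markov kernel from $\mathsf{X}\times\mathsf{T}_1$ to $(\mathsf{T}_2,\mathcal{T}_2)$. Assume that $M_1$ is $(\mathcal{S},\mathcal{Q}_x,\kappa_1,\delta_1)$-PP, and that for every $t\in\mathsf{T}_1$ the mechanism $M_2((\cdot,t),\cdot)$ is $(\mathcal{S},\mathcal{Q}_x,\kappa_2,\delta_2)$-PP. If $\mathcal{Q}_x$ is conjugate to $M_1$ (for every $x\in\mathsf{X}$), then $M_1\otimes M_2$ is $(\mathcal{S},\mathcal{Q}_x,\kappa_1+\kappa_2,\delta_1+\delta_2)$-PP.
   Context: $(\mathsf{X},\mathcal{X})$ is a measurable space of datasets and $\mathcal{P}$ a family of probability distributions on it. A mechanism is a Markov kernel $M$ from $\mathsf{X}$ to a measurable space; $\mathbb{P}_x$ denotes probability when the output $T\sim M(x,\cdot)$. The tensor product is $(M_1\otimes M_2)(x,\mathrm{d}(t_1,t_2))=M_1(x,\mathrm{d}t_1)M_2((x,t_1),\mathrm{d}t_2)$. Posterior: for a prior $Q\in\mathcal{P}$, $Q_T=Q(\cdot\mid M,T)$ is the regular conditional distribution (Bayes posterior) of the data given the observed output $T$, when data $X\sim Q$ and $T\mid X\sim M(X,\cdot)$. Spaces are assumed regular enough that these exist and are almost surely unique. For a two-stage mechanism $M_1\otimes M_2$, the version of the posterior after observing $(T_1,T_2)$ is the one obtained by sequential Bayesian updating: first update $Q$ to $Q_{T_1}$ using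 $T_1$ and $M_1$, then update $Q_{T_1}$ using $T_2$ and the mechanism $M_2((\cdot,T_1),\cdot)$. Scores: a scoring rule $S$ maps $(Q,x)\in\mathcal{P}\times\mathsf{X}$ to $\mathbb{R}\cup\{\pm\infty\}$; it is proper if $\mathbb{E}_{X\sim Q}[S(Q,X)]\le\mathbb{E}_{X\sim Q}[S(P,X)]$ for all $P,Q\in\mathcal{P}$. $\mathcal{S}$ is a non-empty set of proper scoring rules. Persuasive privacy: for each $x\in\mathsf{X}$ let $\mathcal{Q}_x\subset\mathcal{P}$ be a class of priors, and let $\kappa,\delta\ge0$. $M$ is $(\mathcal{S},\mathcal{Q}_x,\kappa,\delta)$-PP if $$\inf_{S\in\mathcal{S}}\inf_{x\in\mathsf{X}}\inf_{Q\in\mathcal{Q}_x}\mathbb{P}_x\left[\Delta_S(Q,T,x)\le\kappa\right]\ge1-\delta,\qquad \Delta_S(Q,T,x)=S(Q,x)-S(Q_T,x),$$ where a difference of equal infinities is $0$. Conjugacy: $\mathcal{Q}_x$ is conjugate to $M$ if for every $Q\in\mathcal{Q}_x$ the posterior $Q(\cdot\mid M,T)$ is in $\mathcal{Q}_x$ almost surely over $T\sim M(z,\cdot)$, for all $z\in\mathsf{X}$. *)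

(* Defs.v *)
From HB Require Import structures.
From mathcomp Require Import all_boot all_order all_algebra.
From mathcomp Require Import all_classical all_reals all_analysis.
From mathcomp Require Import measurable_realfun.

Set Implicit Arguments.
Unset Strict Implicit.
Unset Printing Implicit Defensive.

Import Order.TTheory GRing.Theory Num.Theory.
Import numFieldNormedType.Exports.

Local Open Scope classical_set_scope.
Local Open Scope ring_scope.
Local Open Scope ereal_scope.

Section tensor.
Context d0 d1 d2 (X : measurableType d0) (T1 : measurableType d1)
  (T2 : measurableType d2) (R : realType).
Context (M1 : R.-pker X ~> T1) (M2 : R.-pker (X * T1) ~> T2).

(* M1 (x) M2, with values in the measures; the instance below makes it Markov. *)
Definition ktensor : X -> {measure set (T1 * T2) -> \bar R} :=
  mkproduct M1 M2.

HB.instance Definition _ :=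
  isKernel.Build _ _ _ _ R ktensor (measurable_kproduct M1 M2).

Let ktensor_prob x : ktensor x [set: T1 * T2] = 1.
Proof.
have k1 y : kernel.intker_indic M2 [set: T1 * T2] (x, y) = 1.
  rewrite /kernel.intker_indic; under eq_integral do rewrite indicT.
  by rewrite (integral_cst _ measurableT 1) prob_kernel mule1.
rewrite /ktensor/= /kproduct; under eq_integral do rewrite k1.
by rewrite (integral_cst _ measurableT 1) prob_kernel mule1.
Qed.

HB.instance Definition _ :=
  Kernel_isProbability.Build _ _ _ _ R ktensor ktensor_prob.

(* The mechanism M2((., t), .). *)
Definition kslice (t : T1) : X -> {measure set T2 -> \bar R} :=
  fun x => M2 (x, t).

Let measurable_kslice t U :
  measurable U -> measurable_fun [set: X] (kslice t ^~ U).
Proof.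
move=> mU; exact: (measurable_fun_pair1 t (measurable_kernel M2 U mU)).
Qed.

HB.instance Definition _ t :=
  isKernel.Build _ _ _ _ R (kslice t) (@measurable_kslice t).

Let kslice_prob t x : kslice t x [set: T2] = 1.
Proof. exact: prob_kernel. Qed.

HB.instance Definition _ t :=
  Kernel_isProbability.Build _ _ _ _ R (kslice t) (kslice_prob t).

End tensor.

Section posterior.
Context d d' (X : measurableType d) (T : measurableType d') (R : realType).

(* The law of T when X ~ Q and T | X ~ M(X, .): a probability measure, seen as
   a kernel from the one-point space, is pushed through M. *)
Definition marginal (Q : probability X R) (M : R.-pker X ~> T) :
    {measure set T -> \bar R} :=
  mkcomp_noparam (kprobability
    (measurable_cst (Q : pprobability X R) : measurable_fun [set: unit] _)) M tt.

(* QT is a version of the regular conditional distribution of X given T. *)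
Definition is_posterior (M : R.-pker X ~> T) (Q : probability X R)
    (QT : T -> probability X R) : Prop :=
  measurable_fun [set: T] (QT : T -> pprobability X R) /\
  forall (A : set X) (B : set T), measurable A -> measurable B ->
    \int[Q]_(x in A) M x B = \int[marginal Q M]_(t in B) QT t A.

(* Posteriors are only determined up to null sets of the marginal, so a
   mechanism always comes with the version [post] that is in use:
   [post Q t] is the distribution Q(. | M, t). *)
Definition posterior_map (PP : set (probability X R)) (M : R.-pker X ~> T)
    (post : probability X R -> T -> probability X R) : Prop :=
  forall Q, PP Q -> is_posterior M Q (post Q).

Definition conjugate_class (C : set (probability X R)) (M : R.-pker X ~> T)
    (post : probability X R -> T -> probability X R) : Prop :=
  forall Q, C Q -> forall z : X, {ae M z, forall t, C (post Q t)}.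

End posterior.

(* [post2 t1] is the version in use for the mechanism M2((., t1), .); its prior
   is the posterior after the first stage.  When Q and the posteriors post1 Q t1
   lie in the family on which these are posterior maps and the result is jointly
   measurable, it is a posterior of Q for the tensor product. *)
Definition sequential_posterior d d1 d2 (X : measurableType d)
    (T1 : measurableType d1) (T2 : measurableType d2) (R : realType)
    (post1 : probability X R -> T1 -> probability X R)
    (post2 : T1 -> probability X R -> T2 -> probability X R) :
    probability X R -> T1 * T2 -> probability X R :=
  fun Q t => post2 t.1 (post1 Q t.1) t.2.

Section privacy.
Context d (X : measurableType d) (R : realType).

(* A score is a total function; its values outside the family PP of priors are
   unconstrained up to measurability.  Measurability in x gives a meaning to
   expectations of scores and measurability in the distribution, for the
   sigma-algebra generated by the evaluations Q |-> Q(A), gives a meaning to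
   probabilities of events about posterior scores.  Since a function that is
   measurable for the trace sigma-algebra on PP has a measurable extension,
   every measurable score on PP is covered. *)
Definition scoring_rule (PP : set (probability X R))
    (S : probability X R -> X -> \bar R) : Prop :=
  (forall Q, PP Q -> measurable_fun [set: X] (S Q)) /\
  (forall x, measurable_fun [set: pprobability X R]
     ((fun Q => S Q x) : pprobability X R -> \bar R)).

(* Quasi-integrability: the expectation of f is not of the form oo - oo. *)
Definition has_expectation (Q : probability X R) (f : X -> \bar R) : Prop :=
  \int[Q]_x (f^\+ x) < +oo \/ \int[Q]_x (f^\- x) < +oo.

Definition proper_scoring_rule (PP : set (probability X R))
    (S : probability X R -> X -> \bar R) : Prop :=
  forall P Q, PP P -> PP Q ->
    has_expectation Q (S P) /\ \int[Q]_x S Q x <= \int[Q]_x S P x.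

Definition score_diff (S : probability X R -> X -> \bar R)
    (Q Q' : probability X R) (x : X) : \bar R :=
  if S Q x == S Q' x then 0 else S Q x - S Q' x.

Definition persuasive_private d' (T : measurableType d')
    (SS : set (probability X R -> X -> \bar R))
    (Qc : X -> set (probability X R)) (M : R.-pker X ~> T)
    (post : probability X R -> T -> probability X R) (kappa delta : R) : Prop :=
  (1 - delta)%:E <=
  ereal_inf [set ereal_inf [set ereal_inf
    [set M x [set t | score_diff S Q (post Q t) x <= kappa%:E]
    | Q in Qc x] | x in [set: X]] | S in SS].

End privacy.

(* Main.v *)
Require Import Defs.
From HB Require Import structures.
From mathcomp Require Import all_boot all_order all_algebra.
From mathcomp Require Import all_classical all_reals all_analysis.
From mathcomp Require Import measurable_realfun.
From mathcomp Require Import lra.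

Import Order.TTheory GRing.Theory Num.Theory.
Import numFieldNormedType.Exports.
Local Open Scope classical_set_scope.
Local Open Scope ring_scope.
Local Open Scope ereal_scope.

(** Fix a score [S], a dataset [x] and a prior
    [Q] in [Qc x]. Bounding a score difference by a real [kappa >= 0] says
    exactly that [S Q x <= S Q' x + kappa], also at infinite scores
    ([score_diff_le]); in this form losses add up along the chain from the prior
    to the first posterior to the second one. So the two-stage loss is at most
    [kappa1 + kappa2] as soon as the first output [t1] costs at most [kappa1] and
    the second output costs at most [kappa2] for the prior [post1 Q t1].

    Conjugacy is what makes the second cost controllable: for almost every [t1]
    the updated prior [post1 Q t1] is again in [Qc x], so privacy of the slice
    [M2((., t1), .)] applies to it. Hence, on a set of [t1] of probability at
    least [1 - delta1], the conditional probability of success is at least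
    [1 - delta2], and integrating over [t1] ([ktensor_ge]) gives
    [(1 - delta2)(1 - delta1) >= 1 - (delta1 + delta2)]
    when [delta2 <= 1]. *)

(** The additive form of the loss bound. It contains no difference, hence no
    case distinction at infinities; the sign condition on [kappa] accounts for
    the convention that a difference of equal infinities is [0]. *)
Lemma score_diff_le d (X : measurableType d) (R : realType)
    (S : probability X R -> X -> \bar R) Q Q' x (kappa : R) :
  (0 <= kappa)%R ->
  (score_diff S Q Q' x <= kappa%:E) = (S Q x <= S Q' x + kappa%:E).
Proof.
move=> k0; rewrite /score_diff; case: eqP => [->|].
  by rewrite lee_fin k0 leeDl// lee_fin.
case: (S Q x) => [a||]; case: (S Q' x) => [b||] //= _; try by rewrite !leNye.
- by rewrite -EFinD !lee_fin lerBlDl addrC.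
- by rewrite addye// addeNy leNye leey.
Qed.

Lemma score_diff_trans {d} {X : measurableType d} {R : realType}
    {S : probability X R -> X -> \bar R} {Q Q' Q'' x} {kappa1 kappa2 : R} :
  (0 <= kappa1)%R -> (0 <= kappa2)%R ->
  score_diff S Q Q' x <= kappa1%:E -> score_diff S Q' Q'' x <= kappa2%:E ->
  score_diff S Q Q'' x <= (kappa1 + kappa2)%:E.
Proof.
move=> k1 k2; rewrite !score_diff_le ?addr_ge0// => h1 h2.
by rewrite EFinD addeCA addeC (le_trans h1)// leeD2r// addeC.
Qed.

Lemma measurable_score_diff_le {d d'} {X : measurableType d}
    {T : measurableType d'} {R : realType} {PP : set (probability X R)}
    {S : probability X R -> X -> \bar R} {Q : probability X R}
    {post : T -> probability X R} {x : X} {kappa : R} :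
  (0 <= kappa)%R -> scoring_rule PP S ->
  measurable_fun [set: T] (post : T -> pprobability X R) ->
  measurable [set t | score_diff S Q (post t) x <= kappa%:E].
Proof.
move=> k0 [_ mS] mpost.
have mSpost : measurable_fun [set: T] (fun t => S (post t) x).
  exact: (measurableT_comp (mS x) mpost).
rewrite (_ : [set t | _] = [set t | S Q x <= S (post t) x + kappa%:E]).
  rewrite -[X in measurable X]setTI.
  apply: measurable_lee => //.
  by apply: emeasurable_funD => //; exact: measurable_cst.
by apply/seteqP; split => t /=; rewrite score_diff_le.
Qed.

(** The infima are at least [c] iff every value is, which lets a privacy
    guarantee be used and established at one score, dataset and prior. *)
Lemma persuasive_privateP d d' (X : measurableType d) (T : measurableType d')
    (R : realType) (SS : set (probability X R -> X -> \bar R))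
    (Qc : X -> set (probability X R)) (M : R.-pker X ~> T)
    (post : probability X R -> T -> probability X R) (kappa delta : R) :
  persuasive_private SS Qc M post kappa delta <->
  forall S x Q, SS S -> Qc x Q ->
    (1 - delta)%:E <= M x [set t | score_diff S Q (post Q t) x <= kappa%:E].
Proof.
split=> [h S x Q SSS QcQ|h].
  apply: (le_trans h).
  apply: le_trans; first by apply: ereal_inf_lbound; exists S.
  apply: le_trans; first by apply: ereal_inf_lbound; exists x.
  by apply: ereal_inf_lbound; exists Q.
apply: le_ereal_inf_tmp => _ [S SSS <-].
apply: le_ereal_inf_tmp => _ [x _ <-].
apply: le_ereal_inf_tmp => _ [Q QcQ <-].
exact: h.
Qed.

(** Disintegration: a lower bound [c] on the second-stage probability of the
    sections over [B] is integrated over [B] only, so nothing is required of the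
    sections elsewhere. *)
Lemma ktensor_ge {d d1 d2} {X : measurableType d} {T1 : measurableType d1}
    {T2 : measurableType d2} {R : realType}
    (M1 : R.-pker X ~> T1) (M2 : R.-pker (X * T1) ~> T2) (x : X)
    {A : set (T1 * T2)} {B : set T1} {c : R} :
  measurable A -> measurable B -> (0 <= c)%R ->
  (forall t, B t -> c%:E <= M2 (x, t) (xsection A t)) ->
  c%:E * M1 x B <= ktensor M1 M2 x A.
Proof.
move=> mA mB c0 cB.
have ge0 y : 0 <= kernel.intker_indic M2 A (x, y).
  by rewrite kernel.intker_indicE.
have mk : measurable_fun [set: T1]
    (fun y => kernel.intker_indic M2 A (x, y)).
  exact: measurable_fun_pair2 (kernel.measurable_intker_indic M2 mA).
rewrite -(integral_cst (M1 x) mB c%:E).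
rewrite /ktensor/= /kproduct.
apply: (@le_trans _ _ (\int[M1 x]_(y in B) kernel.intker_indic M2 A (x, y))).
  apply: ge0_le_integral => //.
  - exact: measurable_funS mk.
  - by move=> y By; rewrite kernel.intker_indicE//; exact: cB.
exact: ge0_subset_integral.
Qed.

Theorem proposition3 (R : realType) (d d1 d2 : measure_display)
  (X : measurableType d) (T1 : measurableType d1) (T2 : measurableType d2)
  (PP : set (probability X R))
  (SS : set (probability X R -> X -> \bar R))
  (SS_neq0 : SS !=set0)
  (SS_proper : forall S, SS S -> scoring_rule PP S /\ proper_scoring_rule PP S)
  (Qc : X -> set (probability X R))
  (Qc_sub : forall x, Qc x `<=` PP)
  (kappa1 kappa2 delta1 delta2 : R)
  (kappa1_ge0 : (0 <= kappa1)%R) (kappa2_ge0 : (0 <= kappa2)%R)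
  (delta1_ge0 : (0 <= delta1)%R) (delta2_ge0 : (0 <= delta2)%R)
  (M1 : R.-pker X ~> T1) (M2 : R.-pker (X * T1) ~> T2)
  (post1 : probability X R -> T1 -> probability X R)
  (post2 : T1 -> probability X R -> T2 -> probability X R)
  (post1P : posterior_map PP M1 post1)
  (post2P : forall t : T1, posterior_map PP (kslice M2 t) (post2 t))
  (post12_measurable : forall (x : X) (Q : probability X R), Qc x Q ->
    measurable_fun [set: T1 * T2]
      (sequential_posterior post1 post2 Q : T1 * T2 -> pprobability X R))
  (M1_PP : persuasive_private SS Qc M1 post1 kappa1 delta1)
  (M2_PP : forall t : T1,
    persuasive_private SS Qc (kslice M2 t) (post2 t) kappa2 delta2)
  (Qc_conj : forall x : X, conjugate_class (Qc x) M1 post1) :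
  persuasive_private SS Qc (ktensor M1 M2) (sequential_posterior post1 post2)
    (kappa1 + kappa2)%R (delta1 + delta2)%R.
Proof.
apply/persuasive_privateP => S x Q SSS QcQ.
have [scoreS _] := SS_proper _ SSS.
have [mpost1 _] := post1P _ (Qc_sub _ _ QcQ).
set E1 := [set t | score_diff S Q (post1 Q t) x <= kappa1%:E].
set E := [set t | score_diff S Q (sequential_posterior post1 post2 Q t) x
                  <= (kappa1 + kappa2)%:E].
have mE1 : measurable E1 by exact: measurable_score_diff_le scoreS mpost1.
have mE : measurable E.
  apply: measurable_score_diff_le scoreS (post12_measurable _ _ QcQ).
  exact: addr_ge0.
(* If delta2 > 1, the product of the two lower bounds would have a negative
   factor, but then the claim itself is a negative lower bound. *)
have [d2_le1|d2_gt1] := leP delta2 1%R; last first.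
  apply: (@le_trans _ _ 0) => //; rewrite lee_fin; lra.
have [N [mN N0 subN]] := Qc_conj _ _ QcQ x.
have E1_N : (1 - delta1)%:E <= M1 x (E1 `\` N).
  move/persuasive_privateP: M1_PP => /(_ S x Q SSS QcQ) h.
  suff -> : M1 x (E1 `\` N) = M1 x E1 by [].
  rewrite [RHS](measureDI _ mE1 mN).
  rewrite (@subset_measure0 _ _ _ _ (E1 `&` N) N) ?adde0//.
  exact: measurableI.
apply: le_trans (ktensor_ge M1 M2 x (c := (1 - delta2)%R) mE
  (measurableD mE1 mN) _ _); last 2 first.
- by rewrite subr_ge0.
- move=> t [E1t nNt].
  have Qct : Qc x (post1 Q t) by apply: contrapT => /subN.
  have [mpost2 _] := post2P t _ (Qc_sub _ _ Qct).
  move/persuasive_privateP: (M2_PP t) => /(_ S x _ SSS Qct) /le_trans; apply.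
  apply: le_measure; rewrite ?inE.
  + exact: measurable_score_diff_le scoreS mpost2.
  + exact: measurable_xsection.
  + move=> t2 /= h; apply/xsectionP.
    exact: (score_diff_trans kappa1_ge0 kappa2_ge0 E1t h).
apply: (@le_trans _ _ ((1 - delta2)%:E * (1 - delta1)%:E)).
  rewrite -EFinM lee_fin; nra.
by rewrite lee_wpmul2l// lee_fin subr_ge0.
Qed.
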